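(* Fix numbers of inputs $m,n\ge1$, finite output alphabets $\mathcal A,\mathcal B$, and Hilbert space dimensions. Let $\mathcal Q$ be the set of quantum distribution tuples with these alphabets, numbers of inputs and Hilbert space dimensions, and let $\mathcal L$ be the set of Bell local ones. Let $M$ be any nonlocality monotone on $\mathcal Q$, let $N$ be any nonnegative continuous function on $\mathcal Q$ which vanishes on $\mathcal L$, let $N_{\mathrm{sup}}$ be the supremum of $N$ on $\mathcal Q$, and let $J=[0,N_{\mathrm{sup}})$. Then there is a nondecreasing function $f$ on $J$ such that: - $f(0)=0$; - $f\circ N\le M$, i.e. $f(N(\boldsymbol P))\le M(\boldsymbol P)$ for every $\boldsymbol P\in\mathcal Q$ with $N(\boldsymbol P)\in J$; - for any $s\in J$ and $\epsilon>0$, there is $\boldsymbol P\in\mathcal Q$ for which $N(\boldsymbol P)=s$ and $M(\boldsymbol P)<f(s)+\epsilon$.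
   Context: **Distribution tuples.** Inputs are $x\in\{1,\dots,m\}$ and $y\in\{1,\dots,n\}$, outputs are $a\in\mathcal A$, $b\in\mathcal B$. A distribution tuple is $\boldsymbol P=(P_{x,y}(a,b))_{x,y,a,b}$ where each $P_{x,y}$ is a probability mass function on $\mathcal A\times\mathcal B$. The set of tuples carries the topology of the finite-dimensional real vector space containing it. **Quantum.** $\boldsymbol P$ is quantum (for Hilbert spaces $\mathcal H_A,\mathcal H_B$ of the given dimensions, which may be infinite) if there are a density operator $\rho$ on $\mathcal H_A\otimes\mathcal H_B$ and positive operators $M_{x,a}$ on $\mathcal H_A$, $N_{y,b}$ on $\mathcal H_B$ with $\sum_aM_{x,a}=I_A$ for all $x$, $\sum_bN_{y,b}=I_B$ for all $y$, such that $P_{x,y}(a,b)=\operatorname{tr}(\rho\,M_{x,a}\otimes N_{y,b})$ for all $x,y,a,b$. (A third system held by an eavesdropper, on which the identity acts, may be included without changing this notion.) **Bell local.** $\boldsymbol P$ is Bell local if it is a convex combination of deterministic tuples $\boldsymbol D_{\boldsymbol a,\boldsymbol b}$, $\boldsymbol a=(a_x)_x\in\mathcal A^m$, $\boldsymbol b=(b_y)_y\in\mathcal B^n$, whose component for $(x,y,a,b)$ is $\delta_{a,a_x}\delta_{b,b_y}$. $\mathcal L$ is the set of Bell local elements of $\mathcal Q$ (for infinite-dimensional Hilbert spaces, every Bell local tuple is in $\mathcal Q$). **Nonlocality order.** For no-signaling tuples with the same alphabets and numbers of inputs, $\boldsymbol P$ is not less nonlocal than $\boldsymbol P'$ iff $\boldsymbol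 P'=p_0\boldsymbol L+\sum_{k\ge1}p_k\mathcal T_k(\boldsymbol P)$ with probabilities $p_k\ge0$, $\sum_{k\ge0}p_k=1$, $\boldsymbol L$ a Bell local tuple, and each $\mathcal T_k$ a composition of transformations of the following types (each also in the version for Bob's inputs/outputs $y$, $b$): - input substitution: for given $x,x'$, every $P_{x',y}(a,b)$ is replaced by $P_{x,y}(a,b)$, the other components being unchanged; - input relabeling: a permutation of the inputs $x$; - output relabeling: for a given $x$ and a permutation $\pi$ of $\mathcal A$, every $P_{x,y}(a,b)$ is replaced by $P_{x,y}(\pi(a),b)$; - output coarse graining: for a given $x$, $\mathcal A'\subset\mathcal A$ and $a'\in\mathcal A'$, $P_{x,y}(a,b)$ becomes $\sum_{a''\in\mathcal A'}P_{x,y}(a'',b)$ if $a=a'$, $0$ if $a\in\mathcal A'\setminus\{a'\}$, and is unchanged if $a\notin\mathcal A'$. **Nonlocality monotone on $\mathcal Q$.** A real-valued function $M$ on $\mathcal Q$ that vanishes on $\mathcal L$ and satisfies $M(\boldsymbol P')\le M(\boldsymbol P)$ whenever $\boldsymbol P,\boldsymbol P'\in\mathcal Q$ and $\boldsymbol P$ is not less nonlocal than $\boldsymbol P'$. **Conventions.** $N_{\mathrm{sup}}\in[0,\infty]$; if $N_{\mathrm{sup}}=0$ then $J$ is empty and the assertions about $f$ are vacuous. *)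

(* Defs.v *)
From HB Require Import structures.
From mathcomp Require Import all_boot all_order all_algebra all_fingroup.
From mathcomp Require Import all_classical all_reals all_analysis.
From mathcomp Require Import sesquilinear complex.
From mathcomp Require summability.
Import Order.TTheory GRing.Theory Num.Theory.
Import numFieldNormedType.Exports.

Set Implicit Arguments.
Unset Strict Implicit.
Unset Printing Implicit Defensive.

Local Open Scope classical_set_scope.
Local Open Scope ring_scope.
Local Open Scope complex_scope.

(* [inner u v] is linear in [u] and conjugate-linear in [v]. *)
Record hilbertType (R : realType) := HilbertType {
  hilbert_sort :> completeNormedModType R[i];
  inner : {dot hilbert_sort for @Num.conj R[i]};
  inner_norm : forall u : hilbert_sort, inner u u = `|u| ^+ 2 }.

Definition lin_span (K : numDomainType) (V : lmodType K) (S : set V) : set V :=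
  [set v | exists s : seq (K * V),
     (forall p, p \in s -> S p.2) /\ v = \sum_(p <- s) p.1 *: p.2].

Definition hilbert_basis (R : realType) (H : hilbertType R) (I : choiceType)
    (e : I -> H) : Prop :=
  (forall i j, inner H (e i) (e j) = (i == j)%:R) /\
  dense (lin_span (range e)).

(* Positive bounded operator; in the order of [R[i]], [0 <= z] means that [z]
   is real and nonnegative. *)
Definition positive_operator (R : realType) (H : hilbertType R)
    (T : {linear H -> H}) : Prop :=
  continuous (T : H -> H) /\ forall u : H, 0 <= inner H (T u) u.

(* [T] has trace [z]: the sum of the <e_i, T e_i> converges, along the directed
   set of finite sets of indices, to [z] for every orthonormal basis (e_i).
   Every Hilbert space has an orthonormal basis; the first conjunct records
   this, so that the second one is never vacuous. *)
Definition has_trace (R : realType) (H : hilbertType R) (T : H -> H) (z : R[i])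
    : Prop :=
  (exists (I : choiceType) (e : I -> H), hilbert_basis e) /\
  forall (I : choiceType) (e : I -> H), hilbert_basis e ->
    summability.partial_sum (fun i => inner H (T (e i)) (e i) : R[i]^o)
      @ summability.totally --> (z : R[i]^o).

Definition density_operator (R : realType) (H : hilbertType R)
    (rho : {linear H -> H}) : Prop :=
  positive_operator rho /\ has_trace rho 1.

(* The last two fields determine the Hilbert space tensor product up to a
   unique isomorphism compatible with the maps [tensor]. *)
Record tensorProduct (R : realType) (HA HB : hilbertType R) := TensorProduct {
  tensor_sort :> hilbertType R;
  tensor : {bilinear HA -> HB -> tensor_sort};
  inner_tensor : forall (u u' : HA) (v v' : HB),
    inner tensor_sort (tensor u v) (tensor u' v') = inner HA u u' * inner HB v v';
  tensor_dense :
    dense (lin_span [set w | exists u v, w = tensor u v]) }.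

(* [T] is the operator S1 (x) S2: a bounded operator is determined by its
   values on the product vectors, which span a dense subspace. *)
Definition is_tensor_operator (R : realType) (HA HB : hilbertType R)
    (HAB : tensorProduct HA HB) (S1 : HA -> HA) (S2 : HB -> HB)
    (T : {linear HAB -> HAB}) : Prop :=
  continuous (T : HAB -> HAB) /\
  forall u v, T (tensor HAB u v) = tensor HAB (S1 u) (S2 v).

(* [P (x, y, a, b)] is P_{x,y}(a,b).  As the index type is finite, the topology
   of pointwise convergence is that of the finite-dimensional vector space. *)
Definition dtuple (R : realType) (m n : nat) (A B : finType) : Type :=
  {ptws ('I_m * 'I_n * A * B)%type -> R}.

Definition distribution_tuple (R : realType) (m n : nat) (A B : finType)
    (P : dtuple R m n A B) : Prop :=
  (forall x y a b, 0 <= P (x, y, a, b)) /\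
  (forall x y, \sum_a \sum_b P (x, y, a, b) = 1).

Definition no_signaling (R : realType) (m n : nat) (A B : finType)
    (P : dtuple R m n A B) : Prop :=
  (forall x x' y b, \sum_a P (x, y, a, b) = \sum_a P (x', y, a, b)) /\
  (forall x y y' a, \sum_b P (x, y, a, b) = \sum_b P (x, y', a, b)).

Definition quantum (R : realType) (m n : nat) (A B : finType)
    (HA HB : hilbertType R) (HAB : tensorProduct HA HB)
    : set (dtuple R m n A B) :=
  [set P | distribution_tuple P /\
    exists (rho : {linear HAB -> HAB})
           (M : 'I_m -> A -> {linear HA -> HA})
           (N : 'I_n -> B -> {linear HB -> HB}),
      [/\ density_operator rho,
          (forall x a, positive_operator (M x a)) /\
            (forall x u, \sum_a M x a u = u),
          (forall y b, positive_operator (N y b)) /\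
            (forall y v, \sum_b N y b v = v)
        & forall x y a b, exists T : {linear HAB -> HAB},
            is_tensor_operator (M x a) (N y b) T /\
            has_trace (rho \o T) (P (x, y, a, b))%:C]].

Definition deterministic (R : realType) (m n : nat) (A B : finType)
    (va : {ffun 'I_m -> A}) (vb : {ffun 'I_n -> B}) : dtuple R m n A B :=
  fun c => let '(x, y, a, b) := c in (a == va x)%:R * (b == vb y)%:R.

Definition bell_local (R : realType) (m n : nat) (A B : finType)
    : set (dtuple R m n A B) :=
  [set P | exists w : {ffun 'I_m -> A} * {ffun 'I_n -> B} -> R,
    [/\ forall s, 0 <= w s,
        \sum_s w s = 1
      & forall c, P c = \sum_s w s * deterministic R s.1 s.2 c]].

Inductive alice_transformation (R : realType) (m n : nat) (A B : finType) :
    (dtuple R m n A B -> dtuple R m n A B) -> Prop :=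
| input_substitution (x x' : 'I_m) :
    alice_transformation (fun P c => let '(z, y, a, b) := c in
      P (if z == x' then x else z, y, a, b))
| input_relabeling (s : {perm 'I_m}) :
    alice_transformation (fun P c => let '(z, y, a, b) := c in
      P (s z, y, a, b))
| output_relabeling (x : 'I_m) (s : {perm A}) :
    alice_transformation (fun P c => let '(z, y, a, b) := c in
      P (z, y, if z == x then s a else a, b))
| output_coarse_graining (x : 'I_m) (A' : {set A}) (a' : A) :
    a' \in A' ->
    alice_transformation (fun P c => let '(z, y, a, b) := c in
      if (z == x) && (a \in A') then
        if a == a' then \sum_(a'' in A') P (z, y, a'', b) else 0
      else P (z, y, a, b)).

Definition swap_parties (R : realType) (m n : nat) (A B : finType)
    (P : dtuple R m n A B) : dtuple R n m B A :=
  fun c => let '(y, x, b, a) := c in P (x, y, a, b).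

Inductive local_transformation (R : realType) (m n : nat) (A B : finType) :
    (dtuple R m n A B -> dtuple R m n A B) -> Prop :=
| local_alice T : alice_transformation T -> local_transformation T
| local_bob (T : dtuple R n m B A -> dtuple R n m B A) :
    alice_transformation T ->
    local_transformation (fun P => swap_parties (T (swap_parties P)))
| local_comp T1 T2 : local_transformation T1 -> local_transformation T2 ->
    local_transformation (T1 \o T2).

(* [not_less_nonlocal P P']: P is not less nonlocal than P'. *)
Definition not_less_nonlocal (R : realType) (m n : nat) (A B : finType)
    (P P' : dtuple R m n A B) : Prop :=
  [/\ distribution_tuple P /\ no_signaling P,
      distribution_tuple P' /\ no_signaling P'
    & exists (k : nat) (p0 : R) (p : 'I_k -> R) (L : dtuple R m n A B)
             (T : 'I_k -> dtuple R m n A B -> dtuple R m n A B),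
      [/\ 0 <= p0 /\ (forall i, 0 <= p i),
          p0 + \sum_i p i = 1,
          bell_local L,
          forall i, local_transformation (T i)
        & forall c, P' c = p0 * L c + \sum_i p i * T i P c]].

(* Only the values of [M] on [Q] matter. *)
Definition nonlocality_monotone (R : realType) (m n : nat) (A B : finType)
    (Q : set (dtuple R m n A B)) (M : dtuple R m n A B -> R) : Prop :=
  (forall P, Q P -> bell_local P -> M P = 0) /\
  (forall P P', Q P -> Q P' -> not_less_nonlocal P P' -> M P' <= M P).

(* Main.v *)
(* Take f s to be the infimum of M over the quantum tuples P with s <= N P; it
   is nondecreasing and below M by construction. To attain N P = s exactly, move
   such a P along the segment degrade a0 P t, on which Alice announces her true
   output with probability t and a fixed a0 otherwise. This only changes her
   measurement operators, so the segment stays in Q even for fixed Hilbert space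
   dimensions, where Q need not be convex. Its points are mixtures of P with the
   Bell local tuple at t = 0, hence M does not exceed M P there, while N
   moves continuously from 0 to N P. *)
Require Import Defs.
From HB Require Import structures.
From mathcomp Require Import all_boot all_order all_algebra all_fingroup.
From mathcomp Require Import all_classical all_reals all_analysis.
From mathcomp Require Import finmap sesquilinear complex.
From mathcomp Require summability.
Import Order.TTheory GRing.Theory Num.Theory.
Import numFieldNormedType.Exports.

Set Implicit Arguments.
Unset Strict Implicit.
Unset Printing Implicit Defensive.

Local Open Scope classical_set_scope.
Local Open Scope ring_scope.

Local Existing Instance summability.totally_filter.

(** * Finite linear combinations of operators *)

Definition lincomb (K : nzRingType) (V W : lmodType K) (I : finType)
    (c : I -> K) (T : I -> V -> W) (u : V) : W := \sum_i c i *: T i u.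

Lemma lincomb1 (K : nzRingType) (V W : lmodType K) (I : finType)
    (T : I -> V -> W) (u : V) : lincomb (fun=> 1) T u = \sum_i T i u.
Proof. by apply: eq_bigr => i _; rewrite scale1r. Qed.

Lemma lincomb_is_linear (K : comNzRingType) (V W : lmodType K) (I : finType)
    (c : I -> K) (T : I -> {linear V -> W}) :
  linear (lincomb c (fun i => T i : V -> W)).
Proof.
move=> a u v; rewrite /lincomb scaler_sumr -big_split /=.
by apply: eq_bigr => i _; rewrite linearP scalerDr !scalerA mulrC.
Qed.

HB.instance Definition _ (K : comNzRingType) (V W : lmodType K) (I : finType)
    (c : I -> K) (T : I -> {linear V -> W}) :=
  GRing.isLinear.Build K V W *:%R (lincomb c (fun i => T i : V -> W))
    (lincomb_is_linear c T).

Lemma lincomb_continuous (K : numFieldType) (V W : normedModType K)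
    (I : finType) (c : I -> K) (T : I -> V -> W) :
  (forall i, continuous (T i)) -> continuous (lincomb c T).
Proof.
move=> cT u; apply: cvg_big; first exact: add_continuous.
by move=> i _; apply: cvgZl_tmp; exact: cT.
Qed.

Lemma inner_sumlZ (R : realType) (H : hilbertType R) (I : finType)
    (c : I -> R[i]%C) (u : I -> H) (v : H) :
  inner H (\sum_i c i *: u i) v = \sum_i c i * inner H (u i) v.
Proof.
rewrite linear_sumlz; apply: eq_bigr => i _.
exact: linearZl_LR.
Qed.

(** The set where [f - g] is nonzero is open, so if it were nonempty it would meet the dense span,
    where linearity forces [f = g]. *)
Lemma eq_on_dense_span (K : numFieldType) (V W : normedModType K) (S : set V)
    (f g : {linear V -> W}) :
  dense (lin_span S) -> continuous (f : V -> W) -> continuous (g : V -> W) ->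
  (forall u, S u -> f u = g u) -> f =1 g.
Proof.
move=> dS cf cg fg u; apply/eqP; apply: contrapT => /negP nfg.
have ch : continuous (fun v => f v - g v).
  by move=> v; apply: cvgB; [exact: cf|exact: cg].
have oO : open ((fun v => f v - g v) @^-1` (~` [set 0])).
  apply: open_comp; first by move=> v _; exact: ch.
  rewrite openC; apply: accessible_closed_set1.
  exact/hausdorff_accessible/norm_hausdorff.
have [|v [/= nv [s [sS vs]]]] := dS _ _ oO.
  by exists u => /= /eqP; rewrite subr_eq0; exact/negP.
apply: nv; rewrite vs (linear_sum f) (linear_sum g) -sumrB big_seq.
rewrite big1// => p ps.
by rewrite (linearZ_LR f) (linearZ_LR g) /= (fg _ (sS _ ps)) subrr.
Qed.

Lemma partial_sum_lincomb (K : numFieldType) (J : choiceType) (I : finType)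
    (c : I -> K) (z : I -> J -> K) (X : {fset J}) :
  summability.partial_sum (fun j => \sum_i c i * z i j) X =
  \sum_i c i * summability.partial_sum (z i) X.
Proof.
rewrite /summability.partial_sum exchange_big /=.
by apply: eq_bigr => i _; rewrite mulr_sumr.
Qed.

(** * Uniqueness and linearity of traces *)

Section Trace.
Variables (R : realType) (H : hilbertType R).
Local Open Scope complex_scope.

Lemma has_trace_unique (T : H -> H) (z z' : R[i]) :
  has_trace T z -> has_trace T z' -> z = z'.
Proof.
move=> [[I [e be]] Tz] [_ Tz'].
apply: (@cvg_unique (R[i]^o) _ _ _ z z' (Tz I e be) (Tz' I e be)).
exact: norm_hausdorff.
Qed.

(** Along a fixed basis the partial sums combine linearly, and finite combinations commute with
    limits. The existence of a basis is a separate hypothesis because [I] may be empty. *)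
Lemma has_trace_lincomb (I : finType) (c : I -> R[i]) (T : I -> {linear H -> H})
    (rho : {linear H -> H}) (z : I -> R[i]) :
  (exists (J : choiceType) (e : J -> H), hilbert_basis e) ->
  (forall i, has_trace (rho \o T i) (z i)) ->
  has_trace (rho \o lincomb c (fun i => T i : H -> H)) (\sum_i c i * z i).
Proof.
move=> eb Tz; split=> // J e be.
rewrite [X in X @ _](_ : _ = fun X : {fset J} =>
  \sum_i (c i : R[i]^o) *: (summability.partial_sum
     (fun j => inner H ((rho \o T i) (e j)) (e j) : R[i]^o) X)).
  apply: cvg_big; first exact: add_continuous.
  by move=> i _; apply: cvgZl_tmp; case: (Tz i) => _; exact.
apply/funext => X; rewrite -[RHS]partial_sum_lincomb.
congr summability.partial_sum; apply/funext => j /=.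
rewrite linear_sum -inner_sumlZ; congr (inner H _ _).
by apply: eq_bigr => i _; rewrite linearZ.
Qed.

(** Reduces no-signaling to an identity between operators: a marginal probability depends only on
    the sum of the operators over the discarded outcomes. *)
Lemma eq_sum_traces (I : finType) (T T' : I -> {linear H -> H})
    (rho : {linear H -> H}) (z z' : I -> R) :
  (exists (J : choiceType) (e : J -> H), hilbert_basis e) ->
  (forall i, has_trace (rho \o T i) (z i)%:C) ->
  (forall i, has_trace (rho \o T' i) (z' i)%:C) ->
  lincomb (fun=> 1) (fun i => T i : H -> H) =1
    lincomb (fun=> 1) (fun i => T' i : H -> H) ->
  \sum_i z i = \sum_i z' i.
Proof.
move=> eb Tz Tz' TT'.
have tT := has_trace_lincomb (fun=> 1) eb Tz.
have tT' := has_trace_lincomb (fun=> 1) eb Tz'.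
rewrite (funext TT') in tT.
have := has_trace_unique tT tT'.
under eq_bigr do rewrite mul1r.
under [X in _ = X]eq_bigr do rewrite mul1r.
by rewrite -!rmorph_sum => /complexI.
Qed.

Lemma positive_operator_lincomb (I : finType) (c : I -> R)
    (T : I -> {linear H -> H}) :
  (forall i, 0 <= c i) -> (forall i, positive_operator (T i)) ->
  positive_operator (lincomb (fun i => (c i)%:C) (fun i => T i : H -> H)).
Proof.
move=> c0 T0; split; first by apply: lincomb_continuous => i; case: (T0 i).
move=> u; rewrite /= inner_sumlZ; apply: sumr_ge0 => i _.
by apply: mulr_ge0; [rewrite lecR|case: (T0 i)].
Qed.

End Trace.

(** * Tensor products of operators *)

Section TensorOperator.
Variables (R : realType) (HA HB : hilbertType R) (HAB : tensorProduct HA HB).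

Lemma is_tensor_operator_unique (S1 S1' : HA -> HA) (S2 S2' : HB -> HB)
    (T T' : {linear HAB -> HAB}) :
  S1 =1 S1' -> S2 =1 S2' -> is_tensor_operator S1 S2 T ->
  is_tensor_operator S1' S2' T' -> T =1 T'.
Proof.
move=> e1 e2 [cT ST] [cT' ST'].
apply: (eq_on_dense_span (tensor_dense (t:=HAB)) cT cT').
by move=> _ [u [v ->]]; rewrite ST ST' e1 e2.
Qed.

Lemma is_tensor_operator_lincombl (I : finType) (c : I -> R[i]%C)
    (S1 : I -> HA -> HA) (S2 : HB -> HB) (T : I -> {linear HAB -> HAB}) :
  (forall i, is_tensor_operator (S1 i) S2 (T i)) ->
  is_tensor_operator (lincomb c S1) S2 (lincomb c (fun i => T i : HAB -> HAB)).
Proof.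
move=> ST; split; first by apply: lincomb_continuous => i; case: (ST i).
move=> u v; rewrite /lincomb linear_sumlz; apply: eq_bigr => i _.
by rewrite (ST i).2 linearZl_LR.
Qed.

Lemma is_tensor_operator_lincombr (I : finType) (c : I -> R[i]%C)
    (S1 : HA -> HA) (S2 : I -> HB -> HB) (T : I -> {linear HAB -> HAB}) :
  (forall i, is_tensor_operator S1 (S2 i) (T i)) ->
  is_tensor_operator S1 (lincomb c S2) (lincomb c (fun i => T i : HAB -> HAB)).
Proof.
move=> ST; split; first by apply: lincomb_continuous => i; case: (ST i).
move=> u v; rewrite /lincomb linear_sumr; apply: eq_bigr => i _.
by rewrite (ST i).2 linearZr_LR.
Qed.

End TensorOperator.

(** * Postprocessing and no-signaling of quantum tuples *)

(* w a a' is the probability that Alice announces a on the output a'. *)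
Definition postprocess (R : realType) (m n : nat) (A B : finType)
    (w : A -> A -> R) (P : dtuple R m n A B) : dtuple R m n A B :=
  fun c => let '(x, y, a, b) := c in \sum_a' w a a' * P (x, y, a', b).

Section Quantum.
Variables (R : realType) (m n : nat) (A B : finType).
Variables (HA HB : hilbertType R) (HAB : tensorProduct HA HB).
Implicit Types P : dtuple R m n A B.
Local Notation Q := (@quantum R m n A B HA HB HAB).
Local Open Scope complex_scope.

Lemma distribution_tuple_postprocess (w : A -> A -> R) P :
  (forall a a', 0 <= w a a') -> (forall a', \sum_a w a a' = 1) ->
  distribution_tuple P -> distribution_tuple (postprocess w P).
Proof.
move=> w0 w1 [P0 P1]; split=> [x y a b|x y] /=.
  by apply: sumr_ge0 => a' _; exact: mulr_ge0.
rewrite -(P1 x y) [LHS]exchange_big [RHS]exchange_big /=; apply: eq_bigr => b _.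
rewrite exchange_big /=; apply: eq_bigr => a' _.
by rewrite -mulr_suml w1 mul1r.
Qed.

(** The state and Bob's operators are kept; Alice measures with the sums over [a'] of [w a a'] times
    [M x a'], which are again positive and sum to the identity. *)
Lemma quantum_postprocess (w : A -> A -> R) P :
  (forall a a', 0 <= w a a') -> (forall a', \sum_a w a a' = 1) ->
  Q P -> Q (postprocess w P).
Proof.
move=> w0 w1 [dP [rho [M [N [rhoD [M0 M1] N01 PT]]]]].
split; first exact: distribution_tuple_postprocess.
exists rho.
exists (fun x a => lincomb (fun a' => (w a a')%:C) (fun a' => M x a' : HA -> HA)).
exists N.
split; [exact: rhoD| |exact: N01|].
  split=> [x a|x u]; first exact: positive_operator_lincomb.
  rewrite /= /lincomb exchange_big /= -[RHS](M1 x); apply: eq_bigr => a' _.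
  by rewrite -scaler_suml -rmorph_sum w1 scale1r.
move=> x y a b.
have [T PTa] := choice (fun a' => PT x y a' b).
exists (lincomb (fun a' => (w a a')%:C) (fun a' => T a' : HAB -> HAB)); split.
  by apply: is_tensor_operator_lincombl => a'; case: (PTa a').
rewrite /= rmorph_sum.
under eq_bigr do rewrite rmorphM.
apply: has_trace_lincomb; first by case: rhoD => _ [].
by move=> a'; case: (PTa a').
Qed.

(** Summed over Alice's outcomes, the product operators give the identity tensor [N y b] whatever
    [x] is, and a tensor operator is determined by its factors; symmetrically for Bob. *)
Lemma quantum_no_signaling P : Q P -> no_signaling P.
Proof.
move=> [dP [rho [M [N [[_ [eb _]] [M0 M1] [N0 N1] PT]]]]].
split=> [x x' y b|x y y' a].
  have [T PTa] := choice (fun a => PT x y a b).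
  have [T' PTa'] := choice (fun a => PT x' y a b).
  apply: (eq_sum_traces eb (fun a => (PTa a).2) (fun a => (PTa' a).2)).
  apply: is_tensor_operator_unique
    (is_tensor_operator_lincombl (fun=> 1) (fun a => (PTa a).1))
    (is_tensor_operator_lincombl (fun=> 1) (fun a => (PTa' a).1)) => // u.
  by rewrite !lincomb1 !M1.
have [T PTb] := choice (fun b => PT x y a b).
have [T' PTb'] := choice (fun b => PT x y' a b).
apply: (eq_sum_traces eb (fun b => (PTb b).2) (fun b => (PTb' b).2)).
apply: is_tensor_operator_unique
  (is_tensor_operator_lincombr (fun=> 1) (fun b => (PTb b).1))
  (is_tensor_operator_lincombr (fun=> 1) (fun b => (PTb' b).1)) => // v.
by rewrite !lincomb1 !N1.
Qed.

End Quantum.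

(** * Local models in which Alice's output is constant *)

Lemma sum_indicator (R : comNzRingType) (I : finType) (i : I) (F : I -> R) :
  \sum_j (i == j)%:R * F j = F i.
Proof.
rewrite (bigD1 i)//= eqxx mul1r big1 ?addr0// => j /negPf.
by rewrite eq_sym => ->; rewrite mul0r.
Qed.

(** If the values [f i'] are drawn independently with weights [q i'], this is the marginal at [i].
    The indicator is absorbed into the factor at [i]; by distributivity the other factors sum to
    1. *)
Lemma sum_prod_marginal (R : comNzRingType) (I J : finType) (q : I -> J -> R)
    (i : I) (j : J) : (forall i', \sum_j' q i' j' = 1) ->
  \sum_(f : {ffun I -> J}) (\prod_i' q i' (f i')) * (j == f i)%:R = q i j.
Proof.
move=> q1; pose g i' j' := q i' j' * (if i' == i then (j == j')%:R else 1).
transitivity (\sum_(f : {ffun I -> J}) \prod_i' g i' (f i')).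
  apply: eq_bigr => f _; rewrite /g big_split /=; congr (_ * _).
  by rewrite -big_mkcond big_pred1_eq.
rewrite -(bigA_distr_bigA (R := R) g) (bigD1 i)//=.
rewrite [X in _ * X]big1 => [|i' /negPf i'i].
  rewrite mulr1 /g eqxx; under eq_bigr do rewrite mulrC.
  exact: sum_indicator.
by rewrite /g i'i; under eq_bigr do rewrite mulr1.
Qed.

(** Hidden variable: Alice's strategy is the constant [a0], and Bob draws his answers to all inputs
    independently, that to [y] from [q y]. *)
Lemma bell_local_constant_output (R : realType) (m n : nat) (A B : finType)
    (a0 : A) (q : 'I_n -> B -> R) (P : dtuple R m n A B) :
  (forall y b, 0 <= q y b) -> (forall y, \sum_b q y b = 1) ->
  (forall x y a b, P (x, y, a, b) = (a == a0)%:R * q y b) -> bell_local P.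
Proof.
move=> q0 q1 Pq; pose va0 : {ffun 'I_m -> A} := [ffun=> a0].
exists (fun s : {ffun 'I_m -> A} * {ffun 'I_n -> B} =>
  (va0 == s.1)%:R * \prod_y q y (s.2 y)).
(* Alice's weight is a point mass, so sums over pairs of strategies collapse to sums over Bob's. *)
have red (F : {ffun 'I_m -> A} -> {ffun 'I_n -> B} -> R) :
    \sum_s (va0 == s.1)%:R * F s.1 s.2 =
    \sum_vb F va0 vb.
  rewrite -(pair_bigA _ (fun va vb => (va0 == va)%:R * F va vb)) /=.
  by under eq_bigr do rewrite -mulr_sumr; rewrite sum_indicator.
split=> [s||[[[x y] a] b]].
- by apply: mulr_ge0 => //; exact: prodr_ge0.
- rewrite (red (fun _ vb => \prod_y q y (vb y))) -(bigA_distr_bigA (R := R) q).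
  by rewrite big1.
- rewrite Pq -(sum_prod_marginal y b q1).
  under [RHS]eq_bigr do rewrite -mulrA.
  rewrite (red (fun va vb =>
    \prod_y q y (vb y) * deterministic R va vb (x, y, a, b))).
  rewrite mulr_sumr; apply: eq_bigr => vb _.
  by rewrite /deterministic ffunE mulrCA.
Qed.

(** * The segment from a quantum tuple to a local one *)

Definition reset_channel (R : realType) (A : finType) (a0 : A) (t : R)
    (a a' : A) : R := t * (a == a')%:R + (1 - t) * (a == a0)%:R.

Definition degrade (R : realType) (m n : nat) (A B : finType) (a0 : A)
    (P : dtuple R m n A B) (t : R) : dtuple R m n A B :=
  postprocess (reset_channel a0 t) P.

Section Degrade.
Variables (R : realType) (m n : nat) (A B : finType) (a0 : A).
Variables (HA HB : hilbertType R) (HAB : tensorProduct HA HB).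
Implicit Types P : dtuple R m n A B.
Local Notation Q := (@quantum R m n A B HA HB HAB).

(** Exhibits the tuple as affine in [t], with Bob's marginal in the constant-output term. *)
Lemma degradeE P t x y a b :
  degrade a0 P t (x, y, a, b) =
  t * P (x, y, a, b) + (1 - t) * ((a == a0)%:R * \sum_a' P (x, y, a', b)).
Proof.
rewrite /degrade /= -(sum_indicator a (fun a' => P (x, y, a', b))) !mulr_sumr.
rewrite -big_split /=; apply: eq_bigr => a' _.
by rewrite /reset_channel mulrDl !mulrA.
Qed.

Lemma degrade1 P : degrade a0 P 1 = P.
Proof.
apply/funext => -[[[x y] a] b].
by rewrite degradeE subrr mul0r addr0 mul1r.
Qed.

Lemma quantum_degrade P t : 0 <= t <= 1 -> Q P -> Q (degrade a0 P t).
Proof.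
move=> /andP[t0 t1]; apply: quantum_postprocess => [a a'|a'].
  by apply: addr_ge0; apply: mulr_ge0; rewrite ?subr_ge0.
rewrite big_split /= -!mulr_sumr.
have s1 c : \sum_a (a == c)%:R = 1 :> R.
  by under eq_bigr do rewrite eq_sym -[_%:R]mulr1; rewrite sum_indicator.
by rewrite !s1 !mulr1 addrC subrK.
Qed.

(** At [t = 0] only Bob's marginal survives; by no-signaling it can be computed at a reference input
    [x0]. *)
Lemma bell_local_degrade0 P : (0 < m)%N ->
  distribution_tuple P -> no_signaling P -> bell_local (degrade a0 P 0).
Proof.
move=> m0 [P0 P1] [Ps _]; pose x0 : 'I_m := Ordinal m0.
apply: (@bell_local_constant_output _ _ _ _ _ a0
  (fun y b => \sum_a P (x0, y, a, b))) => [y b|y|x y a b].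
- exact: sumr_ge0.
- by rewrite exchange_big.
- by rewrite degradeE mul0r add0r subr0 mul1r (Ps x x0).
Qed.

Lemma not_less_nonlocal_degrade P t : (0 < m)%N -> 0 <= t <= 1 -> Q P ->
  not_less_nonlocal P (degrade a0 P t).
Proof.
move=> m0 t01 QP; have QPt := quantum_degrade t01 QP.
have [dP dPt] := (proj1 QP, proj1 QPt); have sP := quantum_no_signaling QP.
split; [by []|by split=> //; exact: quantum_no_signaling QPt|].
exists 1%N, (1 - t), (fun=> t), (degrade a0 P 0).
(* The identity transformation, written as relabeling the inputs by the identity permutation. *)
exists (fun=> (fun P c =>
  let '(z, y, a, b) := c in P ((1 : {perm 'I_m})%g z, y, a, b))).
move: t01 => /andP[t0 t1]; split.
- by rewrite subr_ge0.
- by rewrite big_ord1 subrK.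
- exact: bell_local_degrade0.
- by move=> _; apply: local_alice; exact: input_relabeling.
- move=> [[[x y] a] b].
  by rewrite big_ord1 perm1 !degradeE mul0r add0r subr0 mul1r addrC.
Qed.

Lemma degrade_continuous P : continuous (degrade a0 P).
Proof.
(* The pointwise topology is the supremum of those induced by the evaluations, so one coordinate at
   a time suffices. *)
move=> t; apply/cvg_sup => c U [_ [[D oD <-] /= Dc] DU].
suff cc : continuous (fun t => degrade a0 P t c).
  have Dt : \forall u \near t, D (degrade a0 P u c).
    by apply: (cc t D); exact: open_nbhs_nbhs.
  by apply: filterS Dt => u; exact: DU.
move: c {Dc DU} => [[[x y] a] b].
under eq_fun do rewrite degradeE.
move=> u; apply: cvgD; first by apply: cvgM; [exact: cvg_id|exact: cvg_cst].
by apply: cvgM; [apply: cvgB; [exact: cvg_cst|exact: cvg_id]|exact: cvg_cst].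
Qed.

Lemma degrade_ivt (N : dtuple R m n A B -> R) P s :
  {within Q, continuous N} -> Q P -> N (degrade a0 P 0) <= s <= N P ->
  exists2 t, 0 <= t <= 1 & N (degrade a0 P t) = s.
Proof.
move=> cN QP /andP[s0 s1].
have [||t t01 Nt] := @IVT R (N \o degrade a0 P) 0 1 s ler01.
(* [N] is continuous only within [Q], but the path stays in [Q] for [t] in [0,1], so the composite
   is continuous within [0,1]. *)
- apply/subspace_continuousP => t /=; rewrite in_itv/= => t01.
  move/subspace_continuousP : cN => cN.
  apply: cvg_comp (cN _ (quantum_degrade t01 QP)) => U /=.
  move=> /(@degrade_continuous P t) DU.
  have DU' : \forall u \near t, Q (degrade a0 P u) -> U (degrade a0 P u).
    exact: DU.
  apply: filterS DU' => u Du; rewrite /= in_itv /= => u01.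
  by apply: Du; exact: quantum_degrade.
- by rewrite /= degrade1 (le_trans _ s0) ?ge_min ?lexx// le_max s1 orbT.
- by exists t; rewrite // -in_itv.
Qed.

End Degrade.

Theorem proposition2 (R : realType) (m n : nat) (A B : finType)
    (HA HB : hilbertType R) (HAB : tensorProduct HA HB)
    (M N : dtuple R m n A B -> R) :
  (0 < m)%N -> (0 < n)%N ->
  let Q : set (dtuple R m n A B) := @quantum R m n A B HA HB HAB in
  nonlocality_monotone Q M ->
  (forall P, Q P -> 0 <= N P) ->
  {within Q, continuous N} ->
  (forall P, Q P -> bell_local P -> N P = 0) ->
  let Nsup : \bar R := ereal_sup [set (N P)%:E | P in Q] in
  let J : set R := [set s | 0 <= s /\ (s%:E < Nsup)%E] in
  exists f : R -> R,
    [/\ forall s t : R, J s -> J t -> s <= t -> f s <= f t,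
        J 0 -> f 0 = 0,
        forall P, Q P -> J (N P) -> f (N P) <= M P
      & forall s e : R, J s -> 0 < e ->
          exists P, [/\ Q P, N P = s & M P < f s + e]].
Proof.
move=> m0 n0 Q [M0 Mle] N0 cN NL Nsup J.
(* Probabilities over an empty alphabet could not sum to 1, so a quantum tuple provides an output
   [a0]. *)
have output P : Q P -> exists a0 : A, True.
  move=> [[_ P1] _]; have := P1 (Ordinal m0) (Ordinal n0).
  case: (pickP (@predT A)) => [a0 _ _|A0]; first by exists a0.
  by rewrite big_pred0// => /esym/eqP; rewrite oner_eq0.
have t0 : 0 <= (0 : R) <= 1 by rewrite lexx ler01.
have local a0 P : Q P -> bell_local (degrade a0 P 0).
  move=> QP; apply: bell_local_degrade0 => //; first by case: QP.
  exact: quantum_no_signaling QP.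
(* Nonnegativity follows from monotonicity: [P] dominates its local degradation, where [M]
   vanishes. *)
have Mge0 P : Q P -> 0 <= M P.
  move=> QP; have [a0 _] := output P QP.
  rewrite -(M0 _ (quantum_degrade a0 t0 QP) (local a0 P QP)).
  apply: (Mle _ _ QP (quantum_degrade a0 t0 QP)).
  exact: not_less_nonlocal_degrade QP.
pose V s := [set M P | P in [set P | Q P /\ s <= N P]].
have lbV s : lbound (V s) 0 by move=> _ [P [QP _] <-]; exact: Mge0.
have hlbV s : has_lbound (V s) by exists 0.
(* Since [s] is strictly below the supremum, some tuple exceeds it; thus [inf (V s)] is a genuine
   infimum, not a default value. *)
have V0 s : J s -> V s !=set0.
  move=> [_ /ereal_sup_gt [_ [P QP <-]]]; rewrite lte_fin => sP.
  by exists (M P), P => //; split=> //; exact: ltW.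
exists (fun s => inf (V s)); split.
- move=> s t _ Jt st; apply: lb_le_inf; first exact: V0.
  move=> _ [P [QP tP] <-]; apply: ge_inf => //.
  by exists P => //; split=> //; exact: le_trans tP.
- move=> J0; apply/eqP; rewrite eq_le; apply/andP; split; last first.
    by apply: lb_le_inf => //; exact: V0.
  (* A local tuple in [Q], obtained by degrading any element of [Q], puts the value 0 into [V 0]. *)
  have [_ [P [QP _] _]] := V0 _ J0; have [a0 _] := output P QP.
  have QL := quantum_degrade a0 t0 QP.
  rewrite -[leRHS](M0 _ QL (local a0 P QP)); apply: ge_inf => //.
  by exists (degrade a0 P 0) => //; split; [exact: QL|exact: N0 _ QL].
- by move=> P QP _; apply: ge_inf => //; exists P.
- move=> s e Js e0.
  (* A near-minimizer [P] may overshoot [s]; sliding it down its segment until [N] equals [s] does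
     not increase [M]. *)
  have [_ [P [QP sP] <-] MPe] := inf_adherent e0 (conj (V0 s Js) (hlbV s)).
  have [a0 _] := output P QP.
  have [|t t01 Nt] := @degrade_ivt _ _ _ _ _ a0 _ _ _ N P s cN QP.
    by rewrite (NL _ (quantum_degrade a0 t0 QP) (local a0 P QP)) (proj1 Js).
  have QPt := quantum_degrade a0 t01 QP.
  exists (degrade a0 P t); split=> //; apply: le_lt_trans MPe.
  by apply: (Mle _ _ QP QPt); exact: not_less_nonlocal_degrade QP.
Qed.
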